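(* Let $\ell\geq 2$ be an integer, and suppose that $$\left|\mathcal{C}_\ell(\mathrm{i}t)\right|-2\left|\mathcal{C}_\ell(-t)\right|\leq 0\qquad\text{for all real } t\geq 0 .$$ Let $z=x+\mathrm{i}y\in\mathbb{C}$ (with $x,y\in\mathbb{R}$) with $x<0$. Then $\left|\mathcal{C}_\ell(z)\right|<1$.
   Context: For an integer $\ell\ge 1$, $\varphi_\ell$ is the entire function $\varphi_\ell(z)=\sum_{k=0}^{+\infty}\frac{z^k}{(\ell+k)!}=\frac{1}{(\ell-1)!}\int_0^1 e^{(1-\xi)z}\xi^{\ell-1}\,d\xi$, $z\in\mathbb{C}$. Define $$\mathcal{C}_\ell(z):=1-\frac{\varphi_\ell(2z)}{\varphi_\ell(z)}.$$ Here $\mathrm{i}$ is the imaginary unit. *)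

(* Defs.v *)
From Stdlib Require Import Reals Arith Factorial Lra Lia.
From Coquelicot Require Import Coquelicot.
Open Scope R_scope.

(** Coquelicot's [Series] is real-valued: a complex series is summed
    componentwise.  [CSeries_correct] relates this to convergence in [C]. *)
Definition CSeries (a : nat -> C) : C :=
  (Series (fun k => Re (a k)), Series (fun k => Im (a k))).

Definition phi_term (l : nat) (z : C) (k : nat) : C :=
  (z ^ k / RtoC (INR (fact (l + k))))%C.

Definition phi (l : nat) (z : C) : C := CSeries (phi_term l z).

(** [Cinv] is total with [(/ 0 = 0)%C], so [CC l z = 1] wherever
    [phi l z = 0]. *)
Definition CC (l : nat) (z : C) : C := (1 - phi l (2 * z) / phi l z)%C.

Lemma sum_n_Re (a : nat -> C) (n : nat) :
  Re (sum_n a n) = sum_n (fun k => Re (a k)) n.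
Proof.
  induction n as [|n IH].
  - now rewrite !sum_O.
  - now rewrite !sum_Sn, <- IH.
Qed.

Lemma sum_n_Im (a : nat -> C) (n : nat) :
  Im (sum_n a n) = sum_n (fun k => Im (a k)) n.
Proof.
  induction n as [|n IH].
  - now rewrite !sum_O.
  - now rewrite !sum_Sn, <- IH.
Qed.

Lemma CSeries_unique (a : nat -> C) (s : C) :
  is_series (V := C_NormedModule) a s -> CSeries a = s.
Proof.
  intros H. unfold CSeries. destruct s as [s1 s2].
  apply injective_projections; simpl; apply is_series_unique;
    intros P [eps HP].
  - assert (HQ : locally (T := C_UniformSpace) (s1, s2) (fun w => P (Re w))).
    { exists eps. intros w [Hw _]. apply HP, Hw. }
    destruct (H _ HQ) as [N HN]. exists N. intros n Hn.
    specialize (HN n Hn). now rewrite sum_n_Re in HN.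
  - assert (HQ : locally (T := C_UniformSpace) (s1, s2) (fun w => P (Im w))).
    { exists eps. intros w [_ Hw]. apply HP, Hw. }
    destruct (H _ HQ) as [N HN]. exists N. intros n Hn.
    specialize (HN n Hn). now rewrite sum_n_Im in HN.
Qed.

Lemma CSeries_correct (a : nat -> C) :
  ex_series (V := C_NormedModule) a ->
  is_series (V := C_NormedModule) a (CSeries a).
Proof. intros [s Hs]. now rewrite (CSeries_unique a s Hs). Qed.

Lemma phi_is_series (l : nat) (z : C) :
  is_series (V := C_NormedModule) (phi_term l z) (phi l z).
Proof.
  apply CSeries_correct.
  apply (ex_series_le (K := C_AbsRing) (V := C_CompleteNormedModule) _
           (fun k => Cmod z ^ k * / INR (fact k))).
  - intros k. change (Cmod (phi_term l z k) <= Cmod z ^ k * / INR (fact k)).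
    unfold phi_term.
    assert (Hk : 0 < INR (fact k)) by apply INR_fact_lt_0.
    assert (Hlk : 0 < INR (fact (l + k))) by apply INR_fact_lt_0.
    assert (Hle : INR (fact k) <= INR (fact (l + k))).
    { apply le_INR, fact_le. lia. }
    rewrite Cmod_div by (intros E; apply RtoC_inj in E; lra).
    rewrite Cmod_pow, Cmod_R, Rabs_pos_eq by lra.
    apply Rmult_le_compat_l.
    + apply pow_le, Cmod_ge_0.
    + now apply Rinv_le_contravar.
  - exists (exp (Cmod z)).
    apply (is_series_ext (fun k => scal (pow_n (Cmod z) k) (/ INR (fact k)))).
    + intros k. now rewrite pow_n_pow.
    + apply is_exp_Reals.
Qed.

(* Main.v *)
Require Import Defs.
From Stdlib Require Import Reals Factorial Classical ClassicalEpsilon Lra Lia.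
From Coquelicot Require Import Coquelicot.
Open Scope R_scope.

(** The argument is the maximum principle for [CC l] on the left half plane.

    - [CC l] is analytic on [Re z <= 0], because [phi l] has no zero there when
      [l >= 2].  Indeed [z * phi l z = phi (l - 1) z - 1 / (l - 1)!]
      ([phi_shift]), and for [Re z <= 0] the value [phi m z] lies in the disc of
      radius [phi m 0 = 1 / m!] ([phi_norm_le]); for [m >= 1] it equals
      [1 / m!] only at [z = 0] ([phi_eq_max]).
    - At infinity in the half plane [phi (l - 1) z] tends to 0, so
      [z * phi l z] tends to [- 1 / (l - 1)!], and [CC l z] tends to [1 / 2]:
      it is at most [3 / 4] in modulus far away ([CC_norm_le_far]).
    - On the negative real axis [phi l] is positive and [phi l (- t)],
      [phi (l - 1) (- t)] decrease in [t]; with [phi_shift] this places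
      [phi l (- 2 t) / phi l (- t)] strictly between [1 / 2] and 1, so
      [Cmod (CC l (- t)) < 1 / 2] ([CC_negative_real_lt]).  The hypothesis then
      gives [Cmod (CC l (i t)) < 1] for [t >= 0], and complex conjugation gives
      it on the whole imaginary axis.
    - A large rectangle with one side on the imaginary axis has [Cmod (CC l)]
      bounded by a constant below 1 on its boundary, hence inside.

    The facts about [phi m] in the half plane come from restricting it to rays.
    The function [s ^ m * phi m (s * z)] of the real variable [s] has derivative
    [s ^ (m - 1) * phi (m - 1) (s * z)] ([ray_derive]), so bounds and
    monotonicity climb from [phi 0], the exponential, to every [phi m] by
    integration from 0.

    The maximum principle needs no contour integral.  If [f] has a second order
    expansion at [z], the mean of [Cmod f ^ 2] over the four points [z + h],
    [z - h], [z + i h], [z - i h] is at least [Cmod (f z) ^ 2 - O(h ^ 3)],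
    since the quadratic terms of the expansion have mean 0 over these points
    ([expands2_four_point]).  The corresponding mean of [Cmod z ^ 2] exceeds its
    central value by [h ^ 2], so [Cmod f ^ 2 + eps * Cmod z ^ 2] has no interior
    maximum ([maximum_principle_rectangle]). *)

(** * Second order complex expansions *)

(** Order two is what the four-point mean needs: its error must be
    smaller than [h ^ 2].  The existential coefficients make the predicate stable
    under quotients without naming derivatives. *)
Definition expands2 (f : C -> C) (z : C) : Prop :=
  exists (a b c : C) (K d : R), 0 < d /\
    forall w : C, Cmod w <= d ->
      Cmod (f (z + w) - (a + b * w + c * (w * w)))%C <= K * Cmod w ^ 3.

(** The constant coefficient is forced to be [f z] by taking [w = 0]; the radius
    and the error constant may then be normalised, which is the form used
    below. *)
Lemma expands2_centered (f : C -> C) (z : C) :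
  expands2 f z <->
  exists (b c : C) (K d : R), 0 < d <= 1 /\ 0 <= K /\
    forall w : C, Cmod w <= d ->
      Cmod (f (z + w) - (f z + b * w + c * (w * w)))%C <= K * Cmod w ^ 3.
Proof.
  split.
  - intros (a & b & c & K & d & Hd & H).
    assert (Ha : f z = a).
    { generalize (H 0%C). rewrite Cmod_0. intros H0.
      specialize (H0 (Rlt_le _ _ Hd)).
      replace (z + 0)%C with z in H0 by ring.
      assert (E : Cmod (f z - (a + b * 0 + c * (0 * 0)))%C = 0).
      { apply Rle_antisym; [ nra | apply Cmod_ge_0 ]. }
      apply Cmod_eq_0 in E.
      replace (f z) with ((f z - (a + b * 0 + c * (0 * 0))) + a)%C by ring.
      rewrite E. ring. }
    exists b, c, (Rabs K), (Rmin d 1). rewrite Ha.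
    repeat split.
    + apply Rmin_pos; lra.
    + apply Rmin_r.
    + apply Rabs_pos.
    + intros w Hw. eapply Rle_trans.
      * apply H. eapply Rle_trans; [ apply Hw | apply Rmin_l ].
      * apply Rmult_le_compat_r; [ apply pow_le, Cmod_ge_0 | apply Rle_abs ].
  - intros (b & c & K & d & Hd & _ & H).
    exists (f z), b, c, K, d. split; [ lra | exact H ].
Qed.

(** Square [Cmod v >= Cmod p - Cmod (v - p)] and drop the square of the error;
    if [Cmod (v - p) > Cmod p] the lower bound is nonpositive. *)
Lemma Cmod_sq_perturb (v p : C) :
  Cmod p ^ 2 - 2 * Cmod p * Cmod (v - p) <= Cmod v ^ 2.
Proof.
  assert (H := Cmod_triangle v (p - v)).
  replace (v + (p - v))%C with p in H by ring.
  replace (p - v)%C with (- (v - p))%C in H by ring.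
  rewrite Cmod_opp in H.
  generalize (Cmod_ge_0 v) (Cmod_ge_0 p) (Cmod_ge_0 (v - p)). intros.
  destruct (Rle_dec (Cmod (v - p)) (Cmod p)); nra.
Qed.

(** Terms of odd degree in [w] cancel between opposite points, and those in
    [w * w] between [h] and [i h]; only the squared moduli of the three coefficients survive. *)
Lemma quadratic_four_point (a b c : C) (h : R) :
  4 * Cmod a ^ 2 <=
    Cmod (a + b * h + c * (h * h))%C ^ 2
  + Cmod (a + b * (- h) + c * ((- h) * (- h)))%C ^ 2
  + Cmod (a + b * (Ci * h) + c * ((Ci * h) * (Ci * h)))%C ^ 2
  + Cmod (a + b * (- (Ci * h)) + c * ((- (Ci * h)) * (- (Ci * h))))%C ^ 2.
Proof.
  destruct a as [a1 a2], b as [b1 b2], c as [c1 c2].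
  rewrite !Cmod2_alt; simpl.
  match goal with |- _ <= ?X =>
    replace X with (4 * (a1 ^ 2 + a2 ^ 2) + 4 * (b1 ^ 2 + b2 ^ 2) * h ^ 2
                    + 4 * (c1 ^ 2 + c2 ^ 2) * h ^ 4) by ring end.
  assert (0 <= h ^ 2) by nra. assert (0 <= h ^ 4) by nra.
  assert (0 <= b1 ^ 2 + b2 ^ 2) by nra. assert (0 <= c1 ^ 2 + c2 ^ 2) by nra.
  nra.
Qed.

(** Submean inequality: each of the four values differs from the quadratic
    polynomial by [O(h ^ 3)]. *)
Lemma expands2_four_point (f : C -> C) (z : C) :
  expands2 f z ->
  exists K d : R, 0 < d /\ forall h : R, 0 < h <= d ->
    4 * Cmod (f z) ^ 2 - K * h ^ 3 <=
      Cmod (f (z + h)%C) ^ 2 + Cmod (f (z + - h)%C) ^ 2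
    + Cmod (f (z + Ci * h)%C) ^ 2 + Cmod (f (z + - (Ci * h))%C) ^ 2.
Proof.
  intros Hf. apply expands2_centered in Hf.
  destruct Hf as (b & c & K & d & Hd & HK & H).
  set (P := Cmod (f z) + Cmod b + Cmod c).
  exists (8 * P * K), d. split; [ lra | ]. intros h Hh.
  assert (one : forall w : C, Cmod w = h ->
    Cmod (f z + b * w + c * (w * w))%C ^ 2 - 2 * P * K * h ^ 3
      <= Cmod (f (z + w)%C) ^ 2).
  { intros w Hw.
    generalize (H w). rewrite Hw. intros H'. specialize (H' (proj2 Hh)).
    assert (Hp : Cmod (f z + b * w + c * (w * w))%C <= P).
    { eapply Rle_trans; [ apply Cmod_triangle | ].
      eapply Rle_trans;
        [ apply Rplus_le_compat_r, Cmod_triangle | ].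
      rewrite !Cmod_mult, Hw. unfold P.
      generalize (Cmod_ge_0 b) (Cmod_ge_0 c). intros.
      assert (h * h <= 1) by nra. nra. }
    generalize (Cmod_sq_perturb (f (z + w)%C) (f z + b * w + c * (w * w))%C).
    set (p := Cmod (f z + b * w + c * (w * w))%C) in *.
    set (r := Cmod (f (z + w) - (f z + b * w + c * (w * w)))%C) in *.
    assert (0 <= p) by apply Cmod_ge_0.
    assert (0 <= r) by apply Cmod_ge_0.
    assert (p * r <= P * (K * h ^ 3)).
    { apply Rmult_le_compat; assumption. }
    intros. lra. }
  assert (Hh1 : Cmod (RtoC h) = h) by (rewrite Cmod_R; apply Rabs_pos_eq; lra).
  assert (Hh2 : Cmod (Ci * h)%C = h) by (rewrite Cmod_mult, Cmod_Ci, Hh1; ring).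
  generalize (one _ Hh1) (one (- h)%C ltac:(now rewrite Cmod_opp))
    (one _ Hh2) (one (- (Ci * h))%C ltac:(now rewrite Cmod_opp))
    (quadratic_four_point (f z) b c h). lra.
Qed.

(** The coefficients [A], [B], [D] of the quotient are obtained by formal
    division, so that [f - (A + B w + D w^2) g] has only terms of order three and
    more; near [z] the denominator keeps at least half of its modulus. *)
Lemma expands2_div (f g : C -> C) (z : C) :
  expands2 f z -> expands2 g z -> g z <> 0%C ->
  expands2 (fun w => (f w / g w)%C) z.
Proof.
  intros Hf Hg Hnz.
  apply expands2_centered in Hf. apply expands2_centered in Hg.
  destruct Hf as (f1 & f2 & K & d & Hd & HK & Hf).
  destruct Hg as (g1 & g2 & L & e & He & HL & Hg).
  set (f0 := f z) in *. set (g0 := g z) in *.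
  set (A := (f0 / g0)%C). set (B := ((f1 - A * g1) / g0)%C).
  set (D := ((f2 - A * g2 - B * g1) / g0)%C).
  assert (Hm : 0 < Cmod g0) by now apply Cmod_gt_0.
  set (S := Cmod g1 + Cmod g2 + L).
  assert (HS : 0 <= S).
  { unfold S. generalize (Cmod_ge_0 g1) (Cmod_ge_0 g2). lra. }
  set (Q := Cmod A + Cmod B + Cmod D).
  set (T := K + Q * L + Cmod (B * g2 + D * g1) + Cmod (D * g2)).
  exists A, B, D, (T * (2 / Cmod g0)),
    (Rmin (Rmin d e) (Cmod g0 / (2 * (S + 1)))).
  split.
  { repeat apply Rmin_pos; try lra. apply Rdiv_lt_0_compat; lra. }
  intros w Hw.
  assert (Hwd : Cmod w <= d).
  { eapply Rle_trans; [ apply Hw | ]. eapply Rle_trans; apply Rmin_l. }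
  assert (Hwe : Cmod w <= e).
  { eapply Rle_trans; [ apply Hw | ].
    eapply Rle_trans; [ apply Rmin_l | apply Rmin_r ]. }
  assert (HwS : Cmod w * (S + 1) <= Cmod g0 / 2).
  { apply Rle_trans with (Cmod g0 / (2 * (S + 1)) * (S + 1)).
    - apply Rmult_le_compat_r; [ lra | ].
      eapply Rle_trans; [ apply Hw | apply Rmin_r ].
    - right. field. lra. }
  specialize (Hf w Hwd). specialize (Hg w Hwe).
  set (r := (f (z + w) - (f0 + f1 * w + f2 * (w * w)))%C) in *.
  set (s := (g (z + w) - (g0 + g1 * w + g2 * (w * w)))%C) in *.
  set (h := Cmod w) in *.
  assert (Hh : 0 <= h) by apply Cmod_ge_0.
  assert (Hh1 : h <= 1) by lra.
  assert (Hh2 : h * h <= h) by nra.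
  assert (Hh3 : h ^ 3 <= h) by nra.
  assert (Hh4 : h ^ 4 <= h ^ 3).
  { replace (h ^ 4) with (h ^ 3 * h) by ring.
    assert (0 <= h ^ 3) by now apply pow_le. nra. }
  assert (Hgw : Cmod g0 / 2 <= Cmod (g (z + w)%C)).
  { assert (E : g0 = (g (z + w) + (- (g1 * w) + (- (g2 * (w * w)) + - s)))%C).
    { unfold s. ring. }
    assert (Cmod g0 <= Cmod (g (z + w)%C) + (Cmod g1 * h + (Cmod g2 * (h * h) + L * h ^ 3))).
    { rewrite E at 1. eapply Rle_trans; [ apply Cmod_triangle | ].
      apply Rplus_le_compat_l.
      eapply Rle_trans; [ apply Cmod_triangle | ].
      rewrite Cmod_opp, Cmod_mult. apply Rplus_le_compat_l.
      eapply Rle_trans; [ apply Cmod_triangle | ].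
      rewrite !Cmod_opp, !Cmod_mult. apply Rplus_le_compat_l. exact Hg. }
    assert (Cmod g2 * (h * h) <= Cmod g2 * h).
    { apply Rmult_le_compat_l; [ apply Cmod_ge_0 | lra ]. }
    assert (L * h ^ 3 <= L * h) by (apply Rmult_le_compat_l; lra).
    unfold S in HwS. lra. }
  assert (Hgnz : g (z + w)%C <> 0%C).
  { apply Cmod_gt_0. lra. }
  assert (E : (f (z + w) / g (z + w) - (A + B * w + D * (w * w)))%C
    = ((r + (- ((A + B * w + D * (w * w)) * s)
         + (- ((B * g2 + D * g1) * (w * (w * w)))
            + - (D * g2 * (w * (w * (w * w))))))) / g (z + w))%C).
  { assert (Ef : f (z + w)%C = (r + (A * g0 + (B * g0 + A * g1) * w
        + (D * g0 + A * g2 + B * g1) * (w * w)))%C).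
    { unfold r, D, B, A. field. exact Hnz. }
    rewrite Ef. unfold s. field. exact Hgnz. }
  rewrite E, Cmod_div by exact Hgnz.
  assert (HQ : Cmod (A + B * w + D * (w * w))%C <= Q).
  { eapply Rle_trans; [ apply Cmod_triangle | ].
    eapply Rle_trans; [ apply Rplus_le_compat_r, Cmod_triangle | ].
    rewrite !Cmod_mult. fold h. unfold Q.
    generalize (Cmod_ge_0 B) (Cmod_ge_0 D). intros. nra. }
  match goal with |- Cmod ?n / _ <= _ => assert (HN : Cmod n <= T * h ^ 3) end.
  { eapply Rle_trans; [ apply Cmod_triangle | ].
    eapply Rle_trans; [ apply Rplus_le_compat_l, Cmod_triangle | ].
    eapply Rle_trans;
      [ apply Rplus_le_compat_l, Rplus_le_compat_l, Cmod_triangle | ].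
    rewrite !Cmod_opp, (Cmod_mult _ s), (Cmod_mult (B * g2 + D * g1)),
      (Cmod_mult (D * g2)), !(Cmod_mult w). fold h.
    assert (Cmod (A + B * w + D * (w * w))%C * Cmod s <= Q * (L * h ^ 3)).
    { apply Rmult_le_compat; try apply Cmod_ge_0; assumption. }
    assert (Cmod (D * g2) * h ^ 4 <= Cmod (D * g2) * h ^ 3).
    { apply Rmult_le_compat_l; [ apply Cmod_ge_0 | lra ]. }
    unfold T. replace (h * (h * (h * h))) with (h ^ 4) by ring.
    replace (h * (h * h)) with (h ^ 3) by ring. lra. }
  replace (T * (2 / Cmod g0) * h ^ 3) with (T * h ^ 3 * / (Cmod g0 / 2))
    by (field; lra).
  apply Rmult_le_compat.
  - apply Cmod_ge_0.
  - left. apply Rinv_0_lt_compat. lra.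
  - exact HN.
  - apply Rinv_le_contravar; lra.
Qed.

Lemma expands2_minus (f g : C -> C) (z : C) :
  expands2 f z -> expands2 g z -> expands2 (fun w => (f w - g w)%C) z.
Proof.
  intros (a & b & c & K & d & Hd & Hf) (a' & b' & c' & K' & d' & Hd' & Hg).
  exists (a - a')%C, (b - b')%C, (c - c')%C, (K + K'), (Rmin d d').
  split; [ now apply Rmin_pos | ]. intros w Hw.
  specialize (Hf w (Rle_trans _ _ _ Hw (Rmin_l _ _))).
  specialize (Hg w (Rle_trans _ _ _ Hw (Rmin_r _ _))).
  match goal with |- Cmod ?X <= _ =>
    replace X with ((f (z + w) - (a + b * w + c * (w * w)))
      + - (g (z + w) - (a' + b' * w + c' * (w * w))))%C by ring end.
  eapply Rle_trans; [ apply Cmod_triangle | ]. rewrite Cmod_opp. lra.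
Qed.

Lemma expands2_const (k z : C) : expands2 (fun _ => k) z.
Proof.
  exists k, 0%C, 0%C, 0, 1. split; [ lra | ]. intros w _. cbv beta.
  match goal with |- Cmod ?X <= _ => replace X with (RtoC 0) by ring end.
  rewrite Cmod_0. lra.
Qed.

Lemma expands2_scale (f : C -> C) (k z : C) :
  expands2 f (k * z)%C -> expands2 (fun w => f (k * w)%C) z.
Proof.
  intros (a & b & c & K & d & Hd & Hf).
  exists a, (b * k)%C, (c * (k * k))%C, (K * Cmod k ^ 3), (d / (Cmod k + 1)).
  assert (Hk := Cmod_ge_0 k).
  split; [ apply Rdiv_lt_0_compat; lra | ]. intros w Hw.
  assert (Hkw : Cmod (k * w) <= d).
  { rewrite Cmod_mult.
    apply Rle_trans with ((Cmod k + 1) * (d / (Cmod k + 1))).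
    - apply Rmult_le_compat; try apply Cmod_ge_0; lra.
    - right. field. lra. }
  specialize (Hf _ Hkw). rewrite Cmod_mult, Rpow_mult_distr in Hf.
  replace (k * (z + w))%C with (k * z + k * w)%C by ring.
  replace (a + b * k * w + c * (k * k) * (w * w))%C
    with (a + b * (k * w) + c * (k * w * (k * w)))%C by ring.
  lra.
Qed.

(** * The maximum principle on a rectangle *)

(** Compactness enters as a uniform lower bound on a gauge; since the gauge may
    depend on [u], that bound is itself a bound on [u]. *)
Lemma bounded_rectangle (u : R -> R -> R) (a b a' b' : R) :
  (forall x y, a <= x <= b -> a' <= y <= b' -> continuity_2d_pt u x y) ->
  exists M, forall x y, a <= x <= b -> a' <= y <= b' -> u x y <= M.
Proof.
  intros Hu.
  assert (Hd : forall x y, exists d : posreal,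
    a <= x <= b -> a' <= y <= b' ->
    forall x' y', Rabs (x' - x) < d -> Rabs (y' - y) < d ->
      u x' y' <= u x y + 1).
  { intros x y.
    destruct (classic (a <= x <= b /\ a' <= y <= b')) as [[Hx Hy] | Hn].
    - destruct (Hu x y Hx Hy (mkposreal 1 Rlt_0_1)) as [d H].
      exists d. intros _ _ x' y' H1 H2.
      generalize (Rle_abs (u x' y' - u x y)) (H x' y' H1 H2). simpl. lra.
    - exists (mkposreal 1 Rlt_0_1). tauto. }
  assert (Hpos : forall x y, 0 < / (1 + Rabs (u x y))).
  { intros x y. apply Rinv_0_lt_compat. generalize (Rabs_pos (u x y)). lra. }
  set (d1 := fun x y => proj1_sig (constructive_indefinite_description _ (Hd x y))).
  (* the gauge also shrinks where [u] is large, so a lower bound on it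
     bounds [u] *)
  set (delta := fun x y => mkposreal (Rmin (d1 x y) (/ (1 + Rabs (u x y))))
                 (Rmin_pos _ _ (cond_pos (d1 x y)) (Hpos x y))).
  destruct (compactness_value_2d a b a' b' delta) as [d H].
  exists (/ d + 1). intros x y Hx Hy.
  destruct (NNPP _ (H x y Hx Hy)) as (p & q & Hp & Hq & H1 & H2 & H3).
  simpl in H1, H2, H3.
  assert (Hu1 : u x y <= u p q + 1).
  { apply (proj2_sig (constructive_indefinite_description _ (Hd p q)) Hp Hq).
    - eapply Rlt_le_trans; [ apply H1 | apply Rmin_l ].
    - eapply Rlt_le_trans; [ apply H2 | apply Rmin_l ]. }
  assert (H4 : d <= / (1 + Rabs (u p q))).
  { eapply Rle_trans; [ apply H3 | apply Rmin_r ]. }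
  apply Rinv_le_contravar in H4; [ | apply cond_pos ].
  rewrite Rinv_inv in H4. generalize (Rle_abs (u p q)). lra.
Qed.

(** If the supremum [S] were not attained, [/ (S - u)] would be continuous, hence
    bounded, which keeps [u] away from [S]. *)
Lemma max_attained_rectangle (u : R -> R -> R) (a b a' b' : R) :
  a <= b -> a' <= b' ->
  (forall x y, a <= x <= b -> a' <= y <= b' -> continuity_2d_pt u x y) ->
  exists p q, a <= p <= b /\ a' <= q <= b' /\
    forall x y, a <= x <= b -> a' <= y <= b' -> u x y <= u p q.
Proof.
  intros Hab Hab' Hu.
  set (E := fun r => exists x y, a <= x <= b /\ a' <= y <= b' /\ r = u x y).
  destruct (completeness E) as [S [HS1 HS2]].
  { destruct (bounded_rectangle u a b a' b' Hu) as [M HM].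
    exists M. intros r (x & y & Hx & Hy & ->). now apply HM. }
  { exists (u a a'), a, a'. lra. }
  assert (Hle : forall x y, a <= x <= b -> a' <= y <= b' -> u x y <= S).
  { intros x y Hx Hy. apply HS1. now exists x, y. }
  apply NNPP. intros Hno.
  assert (Hlt : forall x y, a <= x <= b -> a' <= y <= b' -> u x y < S).
  { intros x y Hx Hy. destruct (Hle x y Hx Hy) as [ | E']; [ assumption | ].
    exfalso. apply Hno. exists x, y. rewrite E'. auto. }
  destruct (bounded_rectangle (fun x y => / (S - u x y)) a b a' b') as [M HM].
  { intros x y Hx Hy. generalize (Hlt x y Hx Hy). intros.
    apply continuity_2d_pt_inv; [ | lra ].
    apply continuity_2d_pt_minus; [ apply continuity_2d_pt_const | now apply Hu ]. }
  assert (HM0 : 0 < M).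
  { eapply Rlt_le_trans; [ | apply (HM a a'); lra ].
    apply Rinv_0_lt_compat. generalize (Hlt a a'). lra. }
  assert (S <= S - / M).
  { apply HS2. intros r (x & y & Hx & Hy & ->).
    generalize (HM x y Hx Hy) (Hlt x y Hx Hy). intros H1 H2.
    apply Rinv_le_contravar in H1; [ | apply Rinv_0_lt_compat; lra ].
    rewrite Rinv_inv in H1. lra. }
  generalize (Rinv_0_lt_compat _ HM0). lra.
Qed.

Lemma expands2_continuous (f : C -> C) (x y : R) :
  expands2 f (x, y) ->
  continuity_2d_pt (fun s t => Cmod (f (s, t)) ^ 2) x y.
Proof.
  intros Hf. apply expands2_centered in Hf.
  destruct Hf as (b & c & K & d & Hd & HK & H).
  set (P := Cmod b + Cmod c + K).
  assert (HP : 0 <= P).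
  { unfold P. generalize (Cmod_ge_0 b) (Cmod_ge_0 c). lra. }
  assert (HCmod : continuity_2d_pt (fun s t => Cmod (f (s, t))) x y).
  { intros eps. generalize (cond_pos eps); intros He.
    assert (Hr : 0 < Rmin d (eps / (P + 1)) / 2).
    { apply Rdiv_lt_0_compat; [ | lra ].
      apply Rmin_pos; [ lra | apply Rdiv_lt_0_compat; lra ]. }
    exists (mkposreal _ Hr). simpl. intros s t Hs Ht.
    set (w := (s - x, t - y) : C).
    assert (Hw : Cmod w < Rmin d (eps / (P + 1))).
    { replace w with (RtoC (s - x) + Ci * RtoC (t - y))%C
        by (unfold w; apply injective_projections; simpl; ring).
      eapply Rle_lt_trans; [ apply Cmod_triangle | ].
      rewrite Cmod_mult, Cmod_Ci, !Cmod_R. lra. }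
    assert (Hwd : Cmod w <= d).
    { left. eapply Rlt_le_trans; [ apply Hw | apply Rmin_l ]. }
    assert (Hwe : Cmod w < eps / (P + 1)).
    { eapply Rlt_le_trans; [ apply Hw | apply Rmin_r ]. }
    specialize (H w Hwd).
    replace ((x, y) + w)%C with ((s, t) : C) in H
      by (unfold w; apply injective_projections; simpl; ring).
    set (h := Cmod w) in *. assert (Hh : 0 <= h) by apply Cmod_ge_0.
    assert (Hd' : Cmod (f (s, t) - f (x, y))%C <= P * h).
    { replace (f (s, t) - f (x, y))%C with
        ((f (s, t) - (f (x, y) + b * w + c * (w * w))) + (b * w + c * (w * w)))%C
        by ring.
      eapply Rle_trans; [ apply Cmod_triangle | ].
      eapply Rle_trans; [ apply Rplus_le_compat; [ apply H | apply Cmod_triangle ] | ].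
      rewrite !Cmod_mult. fold h. unfold P.
      assert (h * h <= h) by nra. assert (h ^ 3 <= h) by nra.
      generalize (Cmod_ge_0 c). intros. nra. }
    assert (Hlt : P * h < eps).
    { apply Rle_lt_trans with ((P + 1) * h); [ nra | ].
      replace (pos eps) with ((P + 1) * (eps / (P + 1))) by (field; lra).
      apply Rmult_lt_compat_l; lra. }
    assert (T1 := Cmod_triangle (f (x, y)) (f (s, t) - f (x, y))%C).
    assert (T2 := Cmod_triangle (f (s, t)) (- (f (s, t) - f (x, y)))%C).
    rewrite Cmod_opp in T2.
    replace (f (x, y) + (f (s, t) - f (x, y)))%C with (f (s, t)) in T1 by ring.
    replace (f (s, t) + - (f (s, t) - f (x, y)))%C with (f (x, y)) in T2 by ring.
    apply Rabs_def1; lra. }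
  apply (continuity_2d_pt_ext (fun s t => Cmod (f (s, t)) * Cmod (f (s, t)))).
  { intros. ring. }
  now apply continuity_2d_pt_mult.
Qed.

(** Adding [eps * Cmod z ^ 2] makes the submean inequality strict, which rules
    out a maximum in the open rectangle; [eps] is so small that the maximum
    cannot lie on the boundary either if [M] is exceeded somewhere. *)
Lemma maximum_principle_rectangle (f : C -> C) (a b a' b' M : R) :
  a <= b -> a' <= b' -> 0 <= M ->
  (forall x y, a <= x <= b -> a' <= y <= b' -> expands2 f (x, y)) ->
  (forall x y, a <= x <= b -> a' <= y <= b' ->
     x = a \/ x = b \/ y = a' \/ y = b' -> Cmod (f (x, y)) <= M) ->
  forall x y, a <= x <= b -> a' <= y <= b' -> Cmod (f (x, y)) <= M.
Proof.
  intros Hab Hab' HM Hf Hbd x0 y0 Hx0 Hy0.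
  apply Rnot_lt_le. intros Hlt.
  set (B := Rmax (a ^ 2) (b ^ 2) + Rmax (a' ^ 2) (b' ^ 2)).
  assert (HB : forall x y, a <= x <= b -> a' <= y <= b' -> x ^ 2 + y ^ 2 <= B).
  { assert (sq : forall l r t, l <= t <= r -> t ^ 2 <= Rmax (l ^ 2) (r ^ 2)).
    { intros l r t Ht. destruct (Rle_dec 0 t).
      - eapply Rle_trans; [ | apply Rmax_r ]. nra.
      - eapply Rle_trans; [ | apply Rmax_l ]. nra. }
    intros x y Hx Hy. apply Rplus_le_compat; now apply sq. }
  assert (HB0 : 0 <= B) by (generalize (HB x0 y0 Hx0 Hy0); nra).
  set (D := Cmod (f (x0, y0)) ^ 2 - M ^ 2).
  assert (HD : 0 < D) by (unfold D; nra).
  (* small enough that the perturbation cannot make up the gap [D] *)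
  set (eps := D / (2 * (B + 1))).
  assert (Heps : 0 < eps) by (apply Rdiv_lt_0_compat; lra).
  assert (HepsB : eps * B < D).
  { apply Rlt_le_trans with (eps * (2 * (B + 1))); [ nra | ].
    right. unfold eps. field. lra. }
  set (u := fun x y => Cmod (f (x, y)) ^ 2 + eps * (x * x + y * y)).
  destruct (max_attained_rectangle u a b a' b') as (p & q & Hp & Hq & Hmax);
    [ assumption | assumption | | ].
  { intros x y Hx Hy. apply continuity_2d_pt_plus.
    - now apply expands2_continuous, Hf.
    - apply continuity_2d_pt_mult; [ apply continuity_2d_pt_const | ].
      apply continuity_2d_pt_plus; apply continuity_2d_pt_mult;
        first [ apply continuity_2d_pt_id1 | apply continuity_2d_pt_id2 ]. }
  assert (Hup : D + M ^ 2 <= u p q).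
  { eapply Rle_trans; [ | apply (Hmax x0 y0 Hx0 Hy0) ]. unfold u, D. nra. }
  assert (Hint : a < p < b /\ a' < q < b').
  { apply NNPP. intros Hn.
    assert (Hcase : p = a \/ p = b \/ q = a' \/ q = b').
    { destruct (Req_dec p a); [ tauto | ]. destruct (Req_dec p b); [ tauto | ].
      destruct (Req_dec q a'); [ tauto | ]. destruct (Req_dec q b'); [ tauto | ].
      exfalso. apply Hn. lra. }
    generalize (Hbd p q Hp Hq Hcase) (HB p q Hp Hq) (Cmod_ge_0 (f (p, q))).
    intros H1 H2 H3.
    assert (Cmod (f (p, q)) ^ 2 <= M ^ 2) by nra.
    assert (eps * (p ^ 2 + q ^ 2) <= eps * B)
      by (apply Rmult_le_compat_l; lra).
    unfold u in Hup. lra. }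
  destruct (expands2_four_point f (p, q) (Hf p q Hp Hq)) as (K & d & Hd & H4).
  set (h := Rmin (Rmin d (2 * eps / (Rabs K + 1)))
              (Rmin (Rmin (p - a) (b - p)) (Rmin (q - a') (b' - q)))).
  assert (HK := Rabs_pos K).
  assert (Hh : 0 < h).
  { unfold h. repeat apply Rmin_pos; try lra. apply Rdiv_lt_0_compat; lra. }
  assert (Hhd : h <= d) by (unfold h; do 2 (eapply Rle_trans; [ apply Rmin_l | ]); lra).
  assert (HhK : h <= 2 * eps / (Rabs K + 1)).
  { unfold h. eapply Rle_trans; [ apply Rmin_l | ]. apply Rmin_r. }
  assert (Hhin : h <= p - a /\ h <= b - p /\ h <= q - a' /\ h <= b' - q).
  { assert (Hh' := Rmin_r (Rmin d (2 * eps / (Rabs K + 1)))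
              (Rmin (Rmin (p - a) (b - p)) (Rmin (q - a') (b' - q)))).
    fold h in Hh'.
    generalize (Rmin_l (Rmin (p - a) (b - p)) (Rmin (q - a') (b' - q)))
      (Rmin_r (Rmin (p - a) (b - p)) (Rmin (q - a') (b' - q)))
      (Rmin_l (p - a) (b - p)) (Rmin_r (p - a) (b - p))
      (Rmin_l (q - a') (b' - q)) (Rmin_r (q - a') (b' - q)). lra. }
  specialize (H4 h (conj Hh Hhd)).
  replace ((p, q) + RtoC h)%C with ((p + h, q) : C) in H4
    by (apply injective_projections; simpl; ring).
  replace ((p, q) + - RtoC h)%C with ((p - h, q) : C) in H4
    by (apply injective_projections; simpl; ring).
  replace ((p, q) + Ci * RtoC h)%C with ((p, q + h) : C) in H4
    by (apply injective_projections; simpl; ring).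
  replace ((p, q) + - (Ci * RtoC h))%C with ((p, q - h) : C) in H4
    by (apply injective_projections; simpl; ring).
  assert (M1 : u (p + h) q <= u p q) by (apply Hmax; lra).
  assert (M2 : u (p - h) q <= u p q) by (apply Hmax; lra).
  assert (M3 : u p (q + h) <= u p q) by (apply Hmax; lra).
  assert (M4 : u p (q - h) <= u p q) by (apply Hmax; lra).
  unfold u in M1, M2, M3, M4.
  assert (H5 : 4 * eps * h ^ 2 <= K * h ^ 3) by nra.
  assert (H6 : h * (Rabs K + 1) <= 2 * eps).
  { apply Rle_trans with (2 * eps / (Rabs K + 1) * (Rabs K + 1)).
    - apply Rmult_le_compat_r; lra.
    - right. field. lra. }
  assert (H7 : K * h ^ 3 <= 2 * eps * h ^ 2).
  { replace (K * h ^ 3) with (K * h * h ^ 2) by ring.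
    apply Rmult_le_compat_r; [ nra | ].
    generalize (Rle_abs K). nra. }
  assert (0 < eps * h ^ 2) by (apply Rmult_lt_0_compat; nra).
  lra.
Qed.

(** * Series and Taylor expansion of the phi functions *)

Notation is_Cseries := (is_series (K := C_AbsRing) (V := C_NormedModule)).

(** Series lemmas leave goals in the operations of an abstract normed module,
    which [ring] and [field] do not recognise as those of [C]. *)
Ltac module_to_C :=
  change plus with Cplus; change opp with Copp; change scal with Cmult;
  match goal with |- ?x = ?y => change (@eq C x y) end.

Lemma is_Cseries_unique (a : nat -> C) (s t : C) :
  is_Cseries a s -> is_Cseries a t -> s = t.
Proof. intros Hs Ht. now rewrite <- (CSeries_unique a s Hs), (CSeries_unique a t Ht). Qed.

Lemma is_Cseries_norm_le (a : nat -> C) (b : nat -> R) (s : C) (t : R) :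
  is_Cseries a s -> is_series b t -> (forall k, Cmod (a k) <= b k) -> Cmod s <= t.
Proof.
  intros Ha Hb Hab.
  apply (is_lim_seq_le (fun n => Cmod (sum_n a n)) (sum_n b) (Cmod s) t).
  - intros n.
    eapply Rle_trans; [ apply (norm_sum_n_m (K := C_AbsRing) (V := C_NormedModule)) | ].
    apply sum_n_m_le. exact Hab.
  - eapply filterlim_comp; [ apply Ha | ].
    apply (filterlim_norm (K := C_AbsRing) (V := C_NormedModule)).
  - exact Hb.
Qed.

Lemma INR_fact_neq_0_C (n : nat) : RtoC (INR (fact n)) <> 0%C.
Proof. intros E. apply RtoC_inj in E. now apply (INR_fact_neq_0 n). Qed.

Lemma is_series_scal_exp (B r : R) :
  is_series (fun k => B * (r ^ k / INR (fact k))) (B * exp r).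
Proof.
  apply (is_series_ext (fun k => scal B (scal (pow_n r k) (/ INR (fact k))))).
  - intros k. now rewrite pow_n_pow.
  - apply (is_series_scal (K := R_AbsRing) (V := R_NormedModule)), is_exp_Reals.
Qed.

(** Geometric growth of [a] is beaten by the factorial, uniformly in [m];
    the sum is controlled by an exponential. *)
Lemma factorial_term_le (a : nat -> C) (m : nat) (r B : R) :
  (forall k, Cmod (a k) <= B * r ^ k) ->
  forall k, Cmod (a k / RtoC (INR (fact (m + k))))%C <= B * (r ^ k / INR (fact k)).
Proof.
  intros H k.
  rewrite Cmod_div by apply INR_fact_neq_0_C.
  rewrite Cmod_R, Rabs_pos_eq by apply pos_INR.
  unfold Rdiv. rewrite <- Rmult_assoc. apply Rmult_le_compat.
  - apply Cmod_ge_0.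
  - left. apply Rinv_0_lt_compat, INR_fact_lt_0.
  - apply H.
  - apply Rinv_le_contravar; [ apply INR_fact_lt_0 | ].
    apply le_INR, fact_le. lia.
Qed.

Lemma factorial_series (a : nat -> C) (m : nat) (r : R) :
  (forall k, Cmod (a k) <= r ^ k) ->
  is_Cseries (fun k => a k / RtoC (INR (fact (m + k))))%C
    (CSeries (fun k => a k / RtoC (INR (fact (m + k))))%C).
Proof.
  intros H. apply CSeries_correct.
  apply (ex_series_le (K := C_AbsRing) (V := C_CompleteNormedModule) _
           (fun k => 1 * (r ^ k / INR (fact k)))).
  - apply (factorial_term_le a m r 1). intros k. rewrite Rmult_1_l. apply H.
  - exists (1 * exp r). apply is_series_scal_exp.
Qed.

(** [pow_coef j k z] is [binomial(k, j) * z ^ (k - j)], the coefficient of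
    [w ^ j] in [(z + w) ^ k], defined by Pascal's rule so that bounds follow by
    induction on [k]. *)
Fixpoint pow_coef (j k : nat) (z : C) : C :=
  match j, k with
  | O, _ => (z ^ k)%C
  | S _, O => 0%C
  | S j', S k' => (z * pow_coef j k' z + pow_coef j' k' z)%C
  end.

Lemma pow_coef_0 (k : nat) (z : C) : pow_coef 0 k z = (z ^ k)%C.
Proof. now destruct k. Qed.

Lemma pow_coef_1 (k : nat) (z : C) : (z * pow_coef 1 k z = INR k * z ^ k)%C.
Proof.
  induction k as [ | k IH ].
  - simpl. ring.
  - change (pow_coef 1 (S k) z) with (z * pow_coef 1 k z + pow_coef 0 k z)%C.
    rewrite IH, pow_coef_0, S_INR, RtoC_plus. simpl. ring.
Qed.

Lemma pow_coef_le (j k : nat) (z : C) : Cmod (pow_coef j k z) <= (Cmod z + 1) ^ k.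
Proof.
  revert j. induction k as [ | k IH ]; intros j; assert (Hz := Cmod_ge_0 z).
  - destruct j; simpl; [ rewrite Cmod_1 | rewrite Cmod_0 ]; lra.
  - destruct j as [ | j ].
    + rewrite pow_coef_0, Cmod_pow. apply pow_incr. lra.
    + change (pow_coef (S j) (S k) z) with (z * pow_coef (S j) k z + pow_coef j k z)%C.
      eapply Rle_trans; [ apply Cmod_triangle | ]. rewrite Cmod_mult.
      generalize (IH (S j)) (IH j). intros H1 H2. simpl.
      assert (Cmod z * Cmod (pow_coef (S j) k z) <= Cmod z * (Cmod z + 1) ^ k)
        by (apply Rmult_le_compat_l; lra).
      lra.
Qed.

(** By induction, the remainder [r_k] satisfying
    [r_(k+1) = (z + w) * r_k + pow_coef 2 k z * w ^ 3]. *)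
Lemma pow_taylor (z w : C) (k : nat) :
  Cmod w <= 1 ->
  Cmod ((z + w) ^ k - (pow_coef 0 k z + pow_coef 1 k z * w + pow_coef 2 k z * (w * w)))%C
    <= Cmod w ^ 3 * (Cmod z + 2) ^ k.
Proof.
  intros Hw. assert (Hz := Cmod_ge_0 z). assert (Hw0 := Cmod_ge_0 w).
  assert (Hw3 : 0 <= Cmod w ^ 3) by now apply pow_le.
  induction k as [ | k IH ].
  - simpl. match goal with |- Cmod ?X <= _ => replace X with (RtoC 0) by ring end.
    rewrite Cmod_0. simpl in Hw3. lra.
  - set (rk := ((z + w) ^ k - (pow_coef 0 k z + pow_coef 1 k z * w + pow_coef 2 k z * (w * w)))%C) in *.
    replace ((z + w) ^ S k -
      (pow_coef 0 (S k) z + pow_coef 1 (S k) z * w + pow_coef 2 (S k) z * (w * w)))%C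
      with ((z + w) * rk + pow_coef 2 k z * (w * (w * w)))%C.
    2:{ unfold rk. change (pow_coef 1 (S k) z) with (z * pow_coef 1 k z + pow_coef 0 k z)%C.
        change (pow_coef 2 (S k) z) with (z * pow_coef 2 k z + pow_coef 1 k z)%C.
        rewrite !pow_coef_0. simpl. ring. }
    eapply Rle_trans; [ apply Cmod_triangle | ]. rewrite !Cmod_mult.
    assert (Hzw : Cmod (z + w) <= Cmod z + 1)
      by (eapply Rle_trans; [ apply Cmod_triangle | lra ]).
    assert (H1 : Cmod (z + w) * Cmod rk
      <= (Cmod z + 1) * (Cmod w ^ 3 * (Cmod z + 2) ^ k))
      by (apply Rmult_le_compat; try apply Cmod_ge_0; assumption).
    assert (H2 : Cmod (pow_coef 2 k z) <= (Cmod z + 2) ^ k).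
    { eapply Rle_trans; [ apply pow_coef_le | ]. apply pow_incr. lra. }
    replace (Cmod w * (Cmod w * Cmod w)) with (Cmod w ^ 3) by ring.
    assert (H3 : Cmod (pow_coef 2 k z) * Cmod w ^ 3 <= (Cmod z + 2) ^ k * Cmod w ^ 3)
      by (apply Rmult_le_compat_r; assumption).
    simpl pow in *. lra.
Qed.

(** The [j]-th derivative of [phi m] at [z] divided by [j!], obtained by
    differentiating the series termwise. *)
Definition dphi (j m : nat) (z : C) : C :=
  CSeries (fun k => pow_coef j k z / RtoC (INR (fact (m + k))))%C.

Lemma dphi_is_series (j m : nat) (z : C) :
  is_Cseries (fun k => pow_coef j k z / RtoC (INR (fact (m + k))))%C (dphi j m z).
Proof. apply (factorial_series _ m (Cmod z + 1)). intros k. apply pow_coef_le. Qed.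

Lemma dphi_0 (m : nat) (z : C) : dphi 0 m z = phi m z.
Proof.
  apply (is_Cseries_unique (phi_term m z)); [ | apply phi_is_series ].
  apply (is_series_ext (fun k => pow_coef 0 k z / RtoC (INR (fact (m + k))))%C).
  - intros k. now rewrite pow_coef_0.
  - apply dphi_is_series.
Qed.

(** The expansions of the powers are summed with weights [1 / (m + k)!]; the
    remainders are dominated by an exponential series. *)
Lemma phi_taylor (m : nat) (z w : C) :
  Cmod w <= 1 ->
  Cmod (phi m (z + w) - (phi m z + dphi 1 m z * w + dphi 2 m z * (w * w)))%C
    <= exp (Cmod z + 2) * Cmod w ^ 3.
Proof.
  intros Hw.
  set (rest := fun k =>
    ((z + w) ^ k - (pow_coef 0 k z + pow_coef 1 k z * w + pow_coef 2 k z * (w * w)))%C).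
  apply (is_Cseries_norm_le
    (fun k => rest k / RtoC (INR (fact (m + k))))%C
    (fun k => Cmod w ^ 3 * ((Cmod z + 2) ^ k / INR (fact k)))).
  - rewrite <- (dphi_0 m z).
    assert (H := is_series_minus _ _ _ _ (phi_is_series m (z + w))
      (is_series_plus _ _ _ _ (dphi_is_series 0 m z)
        (is_series_plus _ _ _ _ (is_series_scal w _ _ (dphi_is_series 1 m z))
          (is_series_scal (w * w)%C _ _ (dphi_is_series 2 m z))))).
    match type of H with is_series ?a ?s =>
      replace (phi m (z + w) - _)%C with s end.
    + eapply is_series_ext; [ | exact H ]. intros k. unfold rest, phi_term.
      module_to_C. generalize (INR_fact_neq_0_C (m + k)). intros. simpl. field. assumption.
    + module_to_C. ring.
  - rewrite (Rmult_comm (exp _)).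
    apply is_series_scal_exp.
  - apply (factorial_term_le rest m (Cmod z + 2) (Cmod w ^ 3)).
    intros k. now apply pow_taylor.
Qed.

Lemma phi_expands2 (m : nat) (z : C) : expands2 (phi m) z.
Proof.
  exists (phi m z), (dphi 1 m z), (dphi 2 m z), (exp (Cmod z + 2)), 1.
  split; [ lra | ]. intros w. apply phi_taylor.
Qed.

(** Multiplication by [z] shifts the power series by one place; the term of
    index 0 is lost. *)
Lemma phi_shift (m : nat) (z : C) :
  (z * phi (S m) z = phi m z - / RtoC (INR (fact m)))%C.
Proof.
  apply (is_Cseries_unique (fun k => phi_term m z (S k))).
  - eapply is_series_ext;
      [ | apply (is_series_scal z _ _ (phi_is_series (S m) z)) ].
    intros k. unfold phi_term. module_to_C.
    replace (m + S k)%nat with (S m + k)%nat by lia.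
    simpl Cpow. unfold Cdiv. apply Cmult_assoc.
  - apply (is_series_incr_1 (phi_term m z)).
    change plus with Cplus.
    replace (phi m z - / RtoC (INR (fact m)) + phi_term m z 0)%C with (phi m z).
    + apply phi_is_series.
    + unfold phi_term. rewrite Nat.add_0_r. simpl.
      field. apply INR_fact_neq_0_C.
Qed.

(** Euler's identity: on [z ^ k] the operator [z d/dz + (m + 1)] acts as
    [k + m + 1], which cancels the last factor of [(m + 1 + k)!]. *)
Lemma phi_euler (m : nat) (z : C) :
  (z * dphi 1 (S m) z + INR (S m) * phi (S m) z = phi m z)%C.
Proof.
  apply (is_Cseries_unique (phi_term m z)); [ | apply phi_is_series ].
  eapply is_series_ext; [ | apply (is_series_plus _ _ _ _
    (is_series_scal z _ _ (dphi_is_series 1 (S m) z))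
    (is_series_scal (RtoC (INR (S m))) _ _ (phi_is_series (S m) z))) ].
  intros k. module_to_C. unfold phi_term.
  replace (S m + k)%nat with (S (m + k)) by lia.
  rewrite fact_simpl, mult_INR, RtoC_mult.
  assert (H := INR_fact_neq_0_C (m + k)).
  assert (H' : RtoC (INR (S (m + k))) <> 0%C).
  { intros E. apply RtoC_inj in E. now apply (not_0_INR (S (m + k))) in E. }
  replace (z * (pow_coef 1 k z / (INR (S (m + k)) * INR (fact (m + k)))))%C
    with ((z * pow_coef 1 k z) / (INR (S (m + k)) * INR (fact (m + k))))%C
    by (field; now split).
  rewrite pow_coef_1.
  replace (RtoC (INR (S (m + k)))) with (INR (S m) + INR k)%C in *
    by (rewrite <- RtoC_plus, <- plus_INR; f_equal; f_equal; lia).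
  field. now split.
Qed.

Lemma phi_conj (m : nat) (z : C) : phi m (Cconj z) = Cconj (phi m z).
Proof.
  assert (E : forall k, phi_term m (Cconj z) k = Cconj (phi_term m z k)).
  { intros k. unfold phi_term. rewrite Cdiv_conj by apply INR_fact_neq_0_C.
    rewrite Cpow_conj. f_equal. f_equal.
    apply injective_projections; simpl; ring. }
  unfold phi, CSeries, Cconj. cbn [fst snd]. f_equal.
  - apply Series_ext. intros k. now rewrite E, re_conj.
  - rewrite <- Series_opp. apply Series_ext. intros k. now rewrite E, im_conj.
Qed.

(** * The phi functions in the left half plane *)

(** The function [s ^ m * phi m (s * z)] on the ray through [z], viewed through
    the real linear form [Re (e * _)]: this reduces complex estimates to
    real-variable calculus, and suitable choices of [e] recover real part,
    imaginary part and modulus. *)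
Definition ray (e : C) (m : nat) (z : C) (s : R) : R :=
  s ^ m * Re (e * phi m (s * z))%C.

Lemma derivable_pt_lim_quadratic (f : R -> R) (s l K d : R) :
  0 < d -> 0 <= K ->
  (forall h, Rabs h <= d -> Rabs (f (s + h) - f s - l * h) <= K * h ^ 2) ->
  derivable_pt_lim f s l.
Proof.
  intros Hd HK H eps Heps.
  assert (Hpos : 0 < Rmin d (eps / (K + 1))).
  { apply Rmin_pos; [ lra | apply Rdiv_lt_0_compat; lra ]. }
  exists (mkposreal _ Hpos). intros h Hh0 Hh. simpl in Hh.
  assert (Hhd : Rabs h <= d)
    by (left; eapply Rlt_le_trans; [ apply Hh | apply Rmin_l ]).
  assert (Hhe : Rabs h < eps / (K + 1))
    by (eapply Rlt_le_trans; [ apply Hh | apply Rmin_r ]).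
  assert (Hp : 0 < Rabs h) by now apply Rabs_pos_lt.
  replace ((f (s + h) - f s) / h - l) with ((f (s + h) - f s - l * h) / h)
    by (field; assumption).
  rewrite Rabs_div by assumption.
  apply Rle_lt_trans with (K * Rabs h).
  - apply Rmult_le_reg_r with (Rabs h); [ assumption | ].
    replace (Rabs (f (s + h) - f s - l * h) / Rabs h * Rabs h)
      with (Rabs (f (s + h) - f s - l * h)) by (field; lra).
    eapply Rle_trans; [ apply (H h Hhd) | ].
    rewrite <- (pow2_abs h). right. ring.
  - apply Rle_lt_trans with ((K + 1) * Rabs h); [ nra | ].
    replace eps with ((K + 1) * (eps / (K + 1))) by (field; lra).
    apply Rmult_lt_compat_l; lra.
Qed.

Lemma phi_ray_derive (e : C) (m : nat) (z : C) (s : R) :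
  derivable_pt_lim (fun t => Re (e * phi m (t * z))%C) s
    (Re (e * (dphi 1 m (s * z) * z))%C).
Proof.
  set (Q := Cmod e * (Cmod (dphi 2 m (s * z)) * Cmod z ^ 2
              + exp (Cmod (s * z)%C + 2) * Cmod z ^ 2)).
  assert (Hz := Cmod_ge_0 z). assert (He := Cmod_ge_0 e).
  assert (Hexp := exp_pos (Cmod (s * z)%C + 2)).
  apply (derivable_pt_lim_quadratic _ _ _ Q (/ (Cmod z + 1))).
  - apply Rinv_0_lt_compat. lra.
  - unfold Q. apply Rmult_le_pos; [ lra | ].
    generalize (Cmod_ge_0 (dphi 2 m (s * z))). intros.
    assert (0 <= Cmod z ^ 2) by nra. nra.
  - intros h Hh.
    assert (Hw : Cmod (h * z)%C <= 1).
    { rewrite Cmod_mult, Cmod_R.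
      apply Rle_trans with (/ (Cmod z + 1) * (Cmod z + 1)).
      - apply Rmult_le_compat; try apply Rabs_pos; lra.
      - right. field. lra. }
    assert (T := phi_taylor m (s * z) (h * z) Hw).
    replace (s * z + h * z)%C with (RtoC (s + h) * z)%C in T
      by (rewrite RtoC_plus; ring).
    match type of T with Cmod ?X <= _ => set (r := X) in T end.
    replace (Re (e * phi m (RtoC (s + h) * z))%C - Re (e * phi m (s * z))%C
               - Re (e * (dphi 1 m (s * z) * z))%C * h)
      with (Re (e * (dphi 2 m (s * z) * (h * z * (h * z)) + r))%C).
    2:{ replace (Re (e * (dphi 1 m (s * z) * z))%C * h)
          with (Re (e * (dphi 1 m (s * z) * (h * z)))%C)
          by (rewrite <- re_scal_r; f_equal; ring).
        unfold Rminus. rewrite <- !re_opp, <- !re_plus. f_equal.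
        unfold r. ring. }
    eapply Rle_trans; [ apply re_le_Cmod | ].
    rewrite Cmod_mult. unfold Q. rewrite (Rmult_assoc (Cmod e)).
    apply Rmult_le_compat_l; [ lra | ].
    eapply Rle_trans; [ apply Cmod_triangle | ].
    rewrite Rmult_plus_distr_r. apply Rplus_le_compat.
    + rewrite !Cmod_mult, Cmod_R, <- (pow2_abs h). right. ring.
    + eapply Rle_trans; [ apply T | ].
      rewrite (Rmult_assoc (exp _)).
      apply Rmult_le_compat_l; [ lra | ].
      apply Rle_trans with (Cmod (h * z)%C ^ 2).
      * generalize (Cmod_ge_0 (h * z)%C). intros.
        replace (Cmod (h * z)%C ^ 3)
          with (Cmod (h * z)%C ^ 2 * Cmod (h * z)%C) by ring.
        assert (0 <= Cmod (h * z)%C ^ 2) by nra. nra.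
      * rewrite Cmod_mult, Cmod_R, <- (pow2_abs h). right. ring.
Qed.

(** This is [phi_euler] read along the ray. *)
Lemma ray_derive (e : C) (m : nat) (z : C) (s : R) :
  derivable_pt_lim (ray e (S m) z) s (ray e m z s).
Proof.
  replace (ray e m z s) with
    ((INR (S m) * s ^ pred (S m)) * Re (e * phi (S m) (s * z))%C
     + s ^ S m * Re (e * (dphi 1 (S m) (s * z) * z))%C).
  - apply (derivable_pt_lim_mult (fun t => t ^ S m)
      (fun t => Re (e * phi (S m) (t * z))%C)).
    + apply derivable_pt_lim_pow.
    + apply phi_ray_derive.
  - unfold ray. rewrite <- (phi_euler m (s * z)). simpl pred.
    replace (e * (s * z * dphi 1 (S m) (s * z) + INR (S m) * phi (S m) (s * z)))%C
      with (s * (e * (dphi 1 (S m) (s * z) * z))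
            + INR (S m) * (e * phi (S m) (s * z)))%C by ring.
    rewrite re_plus, !re_scal_l. simpl pow. ring.
Qed.

Lemma ray_at_0 (e : C) (m : nat) (z : C) : ray e (S m) z 0 = 0.
Proof. unfold ray. simpl. ring. Qed.

Lemma ray_at_1 (e : C) (m : nat) (z : C) : ray e m z 1 = Re (e * phi m z)%C.
Proof. unfold ray. rewrite pow1, !Cmult_1_l. ring. Qed.

Lemma phi_at_0 (m : nat) : phi m 0 = (/ RtoC (INR (fact m)))%C.
Proof.
  assert (H := phi_shift m 0).
  replace (phi m 0) with ((phi m 0 - / RtoC (INR (fact m))) + / RtoC (INR (fact m)))%C by ring.
  rewrite <- H. ring.
Qed.

(** [phi 0] is the exponential.  Its derivative follows from
    [phi 0 (s z) = 1 + z * (s * phi 1 (s z))] and [ray_derive] at level one. *)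
Lemma ray_0_derive (e z : C) (s : R) :
  derivable_pt_lim (ray e 0 z) s (ray (e * z) 0 z s).
Proof.
  assert (E : forall t, Re e + ray (e * z) 1 z t = ray e 0 z t).
  { intros t. unfold ray.
    rewrite pow_1, pow_O, Rmult_1_l, <- re_scal_l, <- re_plus. f_equal.
    assert (H := phi_shift 0 (t * z)). simpl INR in H.
    replace (phi 0 (t * z)) with ((phi 0 (t * z) - / 1) + 1)%C by (field; apply C1_nz).
    rewrite <- H. ring. }
  rewrite <- (Rplus_0_l (ray (e * z) 0 z s)).
  apply (derivable_pt_lim_ext (fun t => Re e + ray (e * z) 1 z t)); [ exact E | ].
  apply (derivable_pt_lim_plus (fun _ => Re e)).
  - apply derivable_pt_lim_const.
  - apply ray_derive.
Qed.

(** Along the ray, [Cmod (phi 0 (s z)) ^ 2] has derivative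
    [2 * Re z * Cmod (phi 0 (s z)) ^ 2 <= 0] and equals 1 at [s = 0]. *)
Lemma phi_0_norm_le (z : C) : Re z <= 0 -> Cmod (phi 0 z) <= 1.
Proof.
  intros Hz.
  assert (E : forall t, ray 1 0 z t ^ 2 + ray (- Ci) 0 z t ^ 2
                        = Cmod (phi 0 (t * z)) ^ 2).
  { intros t. unfold ray. generalize (phi 0 (t * z)). intros [p q].
    rewrite Cmod2_alt. simpl. ring. }
  destruct (MVT_cor2 (fun t => ray 1 0 z t ^ 2 + ray (- Ci) 0 z t ^ 2)
    (fun t => 2 * Re z * Cmod (phi 0 (t * z)) ^ 2) 0 1 Rlt_0_1) as (c & Hc & _).
  - intros t _.
    replace (2 * Re z * Cmod (phi 0 (t * z)) ^ 2) with
      (INR 2 * ray 1 0 z t ^ pred 2 * ray (1 * z) 0 z t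
       + INR 2 * ray (- Ci) 0 z t ^ pred 2 * ray (- Ci * z) 0 z t).
    + apply derivable_pt_lim_plus.
      * apply (derivable_pt_lim_comp (ray 1 0 z) (fun r => r ^ 2));
          [ apply ray_0_derive | apply derivable_pt_lim_pow ].
      * apply (derivable_pt_lim_comp (ray (- Ci) 0 z) (fun r => r ^ 2));
          [ apply ray_0_derive | apply derivable_pt_lim_pow ].
    + unfold ray. generalize (phi 0 (t * z)). intros [p q].
      rewrite Cmod2_alt. destruct z. simpl. ring.
  - cbv beta in Hc. rewrite !E in Hc.
    rewrite Cmult_1_l, Cmult_0_l, phi_at_0 in Hc.
    replace (Cmod (/ RtoC (INR (fact 0)))) with 1 in Hc
      by (simpl; rewrite Cmod_inv by apply C1_nz; rewrite Cmod_1; field).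
    generalize (Cmod_ge_0 (phi 0 z)). intros.
    assert (0 <= Cmod (phi 0 (c * z)) ^ 2) by (apply pow_le, Cmod_ge_0).
    nra.
Qed.

Lemma nondecreasing_of_derive (f f' : R -> R) (a b : R) :
  a <= b -> (forall t, derivable_pt_lim f t (f' t)) ->
  (forall t, a < t < b -> 0 <= f' t) -> f a <= f b.
Proof.
  intros [Hab | ->] Hf Hf'; [ | lra ].
  destruct (MVT_cor2 f f' a b Hab (fun t _ => Hf t)) as (c & Hc & Hi).
  generalize (Hf' c Hi). nra.
Qed.

Lemma increasing_of_derive (f f' : R -> R) (a b : R) :
  a < b -> (forall t, derivable_pt_lim f t (f' t)) ->
  (forall t, a < t < b -> 0 < f' t) -> f a < f b.
Proof.
  intros Hab Hf Hf'.
  destruct (MVT_cor2 f f' a b Hab (fun t _ => Hf t)) as (c & Hc & Hi).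
  generalize (Hf' c Hi). nra.
Qed.

(** The term [s ^ m / m!] is the value of [ray 1 m] at [z = 0], the expected
    maximum over the half plane; it satisfies the same chain of derivatives
    as [ray], hence so does the difference. *)
Definition gap (e : C) (m : nat) (z : C) (s : R) : R :=
  s ^ m / INR (fact m) - ray e m z s.

Lemma gap_derive (e : C) (m : nat) (z : C) (s : R) :
  derivable_pt_lim (gap e (S m) z) s (gap e m z s).
Proof.
  apply derivable_pt_lim_minus; [ | apply ray_derive ].
  replace (s ^ m / INR (fact m))
    with (/ INR (fact (S m)) * (INR (S m) * s ^ pred (S m))).
  - apply (derivable_pt_lim_ext (fun t => / INR (fact (S m)) * t ^ S m)).
    + intros t. unfold Rdiv. ring.
    + apply derivable_pt_lim_scal, derivable_pt_lim_pow.
  - rewrite fact_simpl, mult_INR. simpl pred. field.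
    split; [ apply INR_fact_neq_0 | now apply not_0_INR ].
Qed.

Lemma gap_at_0 (e : C) (m : nat) (z : C) : gap e (S m) z 0 = 0.
Proof. unfold gap. rewrite ray_at_0. simpl pow. unfold Rdiv. ring. Qed.

(** Integrating from 0, where [gap] vanishes for [m >= 1], carries the bound
    [Cmod (phi 0) <= 1] up to every level. *)
Lemma gap_ge_0 (e : C) (m : nat) (z : C) :
  Cmod e <= 1 -> Re z <= 0 -> forall s, 0 <= s -> 0 <= gap e m z s.
Proof.
  intros He Hz. induction m as [ | m IH ]; intros s Hs.
  - unfold gap, ray. simpl pow. simpl fact. simpl INR.
    assert (Cmod (phi 0 (s * z)) <= 1).
    { apply phi_0_norm_le. rewrite re_scal_l. nra. }
    assert (Re (e * phi 0 (s * z))%C <= 1).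
    { eapply Rle_trans; [ apply Rle_abs | ].
      eapply Rle_trans; [ apply re_le_Cmod | ]. rewrite Cmod_mult.
      generalize (Cmod_ge_0 e) (Cmod_ge_0 (phi 0 (s * z))). nra. }
    lra.
  - rewrite <- (gap_at_0 e m z).
    apply (nondecreasing_of_derive _ (gap e m z)); [ assumption | | ].
    + apply gap_derive.
    + intros t Ht. apply IH. lra.
Qed.

(** Choose the unit [e] that rotates [phi m z] onto the positive real axis. *)
Lemma phi_norm_le (m : nat) (z : C) :
  Re z <= 0 -> Cmod (phi m z) <= / INR (fact m).
Proof.
  intros Hz.
  destruct (Ceq_dec (phi m z) 0) as [E | Hnz].
  { rewrite E, Cmod_0. left. apply Rinv_0_lt_compat, INR_fact_lt_0. }
  assert (Hp : 0 < Cmod (phi m z)) by now apply Cmod_gt_0.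
  assert (Hpc : RtoC (Cmod (phi m z)) <> 0%C) by (intros E; apply RtoC_inj in E; lra).
  set (e := (Cconj (phi m z) / Cmod (phi m z))%C).
  assert (He : Cmod e <= 1).
  { unfold e. rewrite Cmod_div by assumption.
    rewrite Cmod_conj, Cmod_R, Rabs_pos_eq by lra. right. field. lra. }
  assert (H := gap_ge_0 e m z He Hz 1 Rle_0_1).
  unfold gap in H. rewrite ray_at_1, pow1 in H.
  replace (e * phi m z)%C with (RtoC (Cmod (phi m z))) in H.
  - rewrite re_RtoC in H. lra.
  - unfold e. replace (Cconj (phi m z) / Cmod (phi m z) * phi m z)%C
      with ((phi m z * Cconj (phi m z)) / Cmod (phi m z))%C by (field; assumption).
    rewrite <- Cmod2_conj, RtoC_pow. field. assumption.
Qed.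

Lemma derive_0_of_constant (f : R -> R) (a b s c l : R) :
  a < s < b -> (forall t, a < t < b -> f t = c) -> derivable_pt_lim f s l -> l = 0.
Proof.
  intros Hs Hc Hl. apply (uniqueness_limite f s); [ assumption | ].
  apply (derivable_pt_lim_locally_ext (fun _ => c) f s a b); [ assumption | | ].
  - intros t Ht. symmetry. now apply Hc.
  - apply derivable_pt_lim_const.
Qed.

(** Differentiating [m] times, the gap vanishes at level 0 too, so
    [Re (phi 0 (s z)) = 1].  As [Cmod (phi 0 (s z)) <= 1], this forces
    [phi 0 (s z) = 1] for all [s] in the interval, and the derivative [z] of this
    constant function is 0. *)
Lemma gap_zero_inv (m : nat) (z : C) :
  Re z <= 0 -> (forall s, 0 < s < 1 -> gap 1 m z s = 0) -> z = 0%C.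
Proof.
  intros Hz. induction m as [ | m IH ]; intros H.
  - assert (H1 : forall s, 0 < s < 1 -> phi 0 (s * z) = 1%C).
    { intros s Hs.
      assert (N : Cmod (phi 0 (s * z)) <= 1).
      { apply phi_0_norm_le. rewrite re_scal_l. nra. }
      specialize (H s Hs). unfold gap, ray in H. simpl pow in H.
      rewrite Cmult_1_l in H. simpl fact in H. simpl INR in H.
      assert (N2 := Cmod2_alt (phi 0 (s * z))).
      assert (N3 := Cmod_ge_0 (phi 0 (s * z))).
      assert (R1 : Re (phi 0 (s * z)) = 1) by lra.
      rewrite R1 in N2.
      assert (I1 : Im (phi 0 (s * z)) = 0) by nra.
      apply injective_projections; [ exact R1 | exact I1 ]. }
    assert (D : forall e, Re (e * z)%C = 0).
    { intros e.
      assert (Hc : forall s, 0 < s < 1 -> ray e 0 z s = Re e).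
      { intros s Hs. unfold ray. rewrite (H1 s Hs), Cmult_1_r. simpl. ring. }
      assert (D := derive_0_of_constant _ 0 1 (1 / 2) _ _ ltac:(lra) Hc
                     (ray_0_derive e z (1 / 2))).
      unfold ray in D. rewrite H1 in D by lra.
      rewrite Cmult_1_r in D. simpl pow in D. lra. }
    generalize (D 1%C) (D (- Ci)%C). rewrite !re_mult. simpl. intros.
    apply injective_projections; simpl; unfold Re, Im in *; lra.
  - apply IH. intros s Hs.
    destruct (gap_ge_0 1 m z ltac:(rewrite Cmod_1; lra) Hz s ltac:(lra)) as [Hp | E];
      [ exfalso | now symmetry ].
    assert (D := derive_0_of_constant _ 0 1 s 0 _ Hs H (gap_derive 1 m z s)).
    lra.
Qed.

(** The gap is nonnegative, nondecreasing and 0 at [s = 1], hence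
    identically 0 on the unit interval. *)
Lemma phi_eq_max (m : nat) (z : C) :
  Re z <= 0 -> phi (S m) z = (/ RtoC (INR (fact (S m))))%C -> z = 0%C.
Proof.
  intros Hz E. apply (gap_zero_inv (S m)); [ assumption | ]. intros s Hs.
  assert (He : Cmod 1 <= 1) by (rewrite Cmod_1; lra).
  assert (H0 := gap_ge_0 1 (S m) z He Hz s ltac:(lra)).
  assert (H1 : gap 1 (S m) z s <= gap 1 (S m) z 1).
  { apply (nondecreasing_of_derive _ (gap 1 m z)); [ lra | apply gap_derive | ].
    intros t Ht. apply gap_ge_0; [ assumption | assumption | lra ]. }
  assert (H2 : gap 1 (S m) z 1 = 0).
  { unfold gap. rewrite ray_at_1, E, pow1, Cmult_1_l.
    rewrite <- RtoC_inv by apply INR_fact_neq_0.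
    rewrite re_RtoC. unfold Rdiv. ring. }
  lra.
Qed.

(** By [phi_shift], at a zero of [phi (n + 2)] the function [phi (n + 1)] would
    reach its maximal value [1 / (n + 1)!]. *)
Lemma phi_neq_0 (n : nat) (z : C) : Re z <= 0 -> phi (S (S n)) z <> 0%C.
Proof.
  intros Hz E.
  assert (E1 : phi (S n) z = (/ RtoC (INR (fact (S n))))%C).
  { assert (H := phi_shift (S n) z). rewrite E in H.
    replace (phi (S n) z) with
      ((phi (S n) z - / RtoC (INR (fact (S n)))) + / RtoC (INR (fact (S n))))%C by ring.
    rewrite <- H. ring. }
  apply phi_eq_max in E1; [ | assumption ].
  rewrite E1, phi_at_0 in E.
  apply (C1_nz). rewrite <- (Cinv_r (RtoC (INR (fact (S (S n)))))).
  - rewrite E. ring.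
  - apply INR_fact_neq_0_C.
Qed.

Lemma phi_0_exp (x : R) : Re (phi 0 (RtoC x)) = exp x.
Proof.
  unfold phi, CSeries. cbn [fst Re].
  rewrite <- (Rmult_1_l (exp x)).
  apply is_series_unique.
  eapply is_series_ext; [ | apply is_series_scal_exp ].
  intros k. cbv beta. unfold phi_term. rewrite Nat.add_0_l.
  rewrite <- RtoC_pow. unfold Cdiv.
  rewrite <- RtoC_inv by apply INR_fact_neq_0. rewrite <- RtoC_mult, re_RtoC.
  unfold Rdiv. match goal with |- ?u = ?v => change (@eq R u v) end. ring.
Qed.

Lemma phi_real (m : nat) (x : R) : phi m (RtoC x) = RtoC (Re (phi m (RtoC x))).
Proof.
  assert (H := phi_conj m (RtoC x)).
  replace (Cconj (RtoC x)) with (RtoC x) in H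
    by (apply injective_projections; simpl; ring).
  apply (f_equal Im) in H. rewrite im_conj in H.
  apply injective_projections; [ reflexivity | ].
  change (Im (phi m (RtoC x)) = 0). lra.
Qed.

(** Both inequalities hold for the exponential and are integrated along rays
    from 0. *)
Lemma phi_negative_decreasing (m : nat) (a b : R) :
  0 <= a < b ->
  0 < Re (phi m (RtoC (- b))) < Re (phi m (RtoC (- a))).
Proof.
  intros Hab.
  assert (H : forall k s, 0 < s ->
    0 < ray 1 k (RtoC (- b)) s < ray 1 k (RtoC (- a)) s).
  { induction k as [ | k IH ]; intros s Hs.
    - unfold ray. rewrite !Cmult_1_l, <- !RtoC_mult, !phi_0_exp.
      rewrite pow_O, !Rmult_1_l.
      split; [ apply exp_pos | apply exp_increasing; nra ].
    - split.
      + rewrite <- (ray_at_0 1 k (RtoC (- b))).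
        apply (increasing_of_derive _ (ray 1 k (RtoC (- b)))); [ assumption | | ].
        * apply ray_derive.
        * intros t Ht. apply IH. lra.
      + assert (Hd : 0 < ray 1 (S k) (RtoC (- a)) s - ray 1 (S k) (RtoC (- b)) s).
        { replace 0 with (ray 1 (S k) (RtoC (- a)) 0 - ray 1 (S k) (RtoC (- b)) 0)
            by (rewrite !ray_at_0; ring).
          apply (increasing_of_derive
            (fun t => ray 1 (S k) (RtoC (- a)) t - ray 1 (S k) (RtoC (- b)) t)
            (fun t => ray 1 k (RtoC (- a)) t - ray 1 k (RtoC (- b)) t));
            [ assumption | | ].
          - intros t. apply derivable_pt_lim_minus; apply ray_derive.
          - intros t Ht. generalize (IH t ltac:(lra)). lra. }
        lra. }
  generalize (H m 1 Rlt_0_1). rewrite !ray_at_1, !Cmult_1_l. trivial.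
Qed.

(** * The quotient function *)

Lemma CC_expands2 (n : nat) (z : C) : Re z <= 0 -> expands2 (CC (S (S n))) z.
Proof.
  intros Hz.
  apply (expands2_minus (fun _ => 1%C)
    (fun w => (phi (S (S n)) (2 * w) / phi (S (S n)) w)%C)).
  - apply expands2_const.
  - apply expands2_div.
    + apply (expands2_scale (phi (S (S n))) 2), phi_expands2.
    + apply phi_expands2.
    + now apply phi_neq_0.
Qed.

Lemma CC_quotient (l : nat) (z : C) :
  phi l z <> 0%C -> CC l z = ((phi l z - phi l (2 * z)) / phi l z)%C.
Proof. intros H. unfold CC. field. exact H. Qed.

(** From [phi_shift], [Cmod z * Cmod (phi (n + 1) z) <= 2 / n!].  The constants 24
    and 12 are chosen to bring [CC] below [3 / 4] in [CC_norm_le_far]. *)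
Lemma phi_norm_le_far (n : nat) (z : C) :
  Re z <= 0 -> 24 * INR (S n) <= Cmod z ->
  Cmod (phi (S n) z) <= / INR (fact (S n)) / 12.
Proof.
  intros Hz Hfar.
  assert (Hn : 0 < INR (S n)) by (apply lt_0_INR; lia).
  assert (Hf := INR_fact_lt_0 n).
  assert (H : Cmod z * Cmod (phi (S n) z) <= 2 * / INR (fact n)).
  { rewrite <- Cmod_mult, phi_shift. unfold Cminus.
    eapply Rle_trans; [ apply Cmod_triangle | ].
    rewrite Cmod_opp, Cmod_inv by apply INR_fact_neq_0_C.
    rewrite Cmod_R, Rabs_pos_eq by lra.
    generalize (phi_norm_le n z Hz). lra. }
  assert (H' : 24 * INR (S n) * Cmod (phi (S n) z) <= 2 * / INR (fact n)).
  { eapply Rle_trans; [ | apply H ].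
    apply Rmult_le_compat_r; [ apply Cmod_ge_0 | assumption ]. }
  rewrite fact_simpl, mult_INR.
  apply Rmult_le_reg_l with (24 * INR (S n)); [ lra | ].
  eapply Rle_trans; [ apply H' | ]. right. field. lra.
Qed.

(** With [w = 1 / (n + 1)!], the numerator times [2 z] is [2 u - v - w] and the
    denominator times [z] is [u - w], where [u] and [v] are at most [w / 12] in
    modulus; the quotient is at most [15 / 22]. *)
Lemma CC_norm_le_far (n : nat) (z : C) :
  Re z <= 0 -> 24 * INR (S n) <= Cmod z -> Cmod (CC (S (S n)) z) <= 3 / 4.
Proof.
  intros Hz Hfar.
  assert (Hnz := phi_neq_0 n z Hz).
  assert (Hn : 0 < INR (S n)) by (apply lt_0_INR; lia).
  rewrite CC_quotient, Cmod_div by assumption.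
  set (p := phi (S (S n)) z) in *. set (q := phi (S (S n)) (2 * z)).
  set (u := phi (S n) z). set (v := phi (S n) (2 * z)).
  set (w := (/ RtoC (INR (fact (S n))))%C).
  assert (Ew : Cmod w = / INR (fact (S n))).
  { unfold w. rewrite Cmod_inv by apply INR_fact_neq_0_C.
    rewrite Cmod_R, Rabs_pos_eq; [ reflexivity | apply pos_INR ]. }
  assert (Hw : 0 < Cmod w) by (rewrite Ew; apply Rinv_0_lt_compat, INR_fact_lt_0).
  assert (Hu : Cmod u <= Cmod w / 12) by (rewrite Ew; now apply phi_norm_le_far).
  assert (C2 : Cmod 2 = 2) by (rewrite Cmod_R; apply Rabs_pos_eq; lra).
  assert (Hv : Cmod v <= Cmod w / 12).
  { rewrite Ew. apply phi_norm_le_far.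
    - rewrite re_scal_l. lra.
    - rewrite Cmod_mult, C2. lra. }
  assert (Ep : (z * p = u - w)%C) by apply phi_shift.
  assert (Eq : (2 * z * q = v - w)%C) by apply phi_shift.
  assert (Hp0 : 0 < Cmod p) by now apply Cmod_gt_0.
  assert (Hz0 : 0 < Cmod z) by lra.
  assert (Hp : 11 / 12 * Cmod w <= Cmod z * Cmod p).
  { rewrite <- Cmod_mult, Ep.
    assert (T := Cmod_triangle u (w - u)).
    assert (T' := Cmod_triangle (w - u) u).
    replace (w - u + u)%C with w in T' by ring.
    replace (u - w)%C with (- (w - u))%C by ring. rewrite Cmod_opp. lra. }
  assert (Hq : 2 * (Cmod z * Cmod (p - q)) <= 15 / 12 * Cmod w).
  { replace (2 * (Cmod z * Cmod (p - q))) with (Cmod (2 * z * (p - q)))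
      by (rewrite !Cmod_mult, C2; ring).
    replace (2 * z * (p - q))%C with (u + (u + (- v + - w)))%C.
    - eapply Rle_trans; [ apply Cmod_triangle | ].
      eapply Rle_trans; [ apply Rplus_le_compat_l, Cmod_triangle | ].
      eapply Rle_trans;
        [ apply Rplus_le_compat_l, Rplus_le_compat_l, Cmod_triangle | ].
      rewrite !Cmod_opp. lra.
    - replace (2 * z * (p - q))%C with (2 * (z * p) - 2 * z * q)%C by ring.
      rewrite Ep, Eq. ring. }
  apply Rmult_le_reg_r with (Cmod z * Cmod p); [ now apply Rmult_lt_0_compat | ].
  replace (Cmod (p - q) / Cmod p * (Cmod z * Cmod p))
    with (Cmod z * Cmod (p - q)) by (field; lra).
  lra.
Qed.

(** For [t > 0], with [p = phi l (- t)] and [q = phi l (- 2 t)], monotonicity of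
    [phi l] gives [q < p], and that of [phi (l - 1)] gives [t * p < 2 * t * q]; hence
    [0 < (p - q) / p < 1 / 2]. *)
Lemma CC_negative_real_lt (n : nat) (t : R) :
  0 <= t -> Cmod (CC (S (S n)) (RtoC (- t))) < 1 / 2.
Proof.
  intros [Ht | <-].
  - assert (Hnz := phi_neq_0 n (RtoC (- t)) ltac:(rewrite re_RtoC; lra)).
    rewrite CC_quotient by exact Hnz.
    replace (2 * RtoC (- t))%C with (RtoC (- (2 * t)))
      by (rewrite !RtoC_opp, RtoC_mult; ring).
    assert (Hpq := phi_negative_decreasing (S (S n)) t (2 * t) ltac:(lra)).
    assert (Huv := phi_negative_decreasing (S n) t (2 * t) ltac:(lra)).
    assert (H1 := phi_shift (S n) (RtoC (- t))).
    assert (H2 := phi_shift (S n) (RtoC (- (2 * t)))).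
    rewrite <- RtoC_inv in H1, H2 by apply INR_fact_neq_0.
    rewrite (phi_real (S n) (- t)), (phi_real (S (S n)) (- t)) in H1.
    rewrite (phi_real (S n) (- (2 * t))), (phi_real (S (S n)) (- (2 * t))) in H2.
    rewrite (phi_real (S (S n)) (- t)), (phi_real (S (S n)) (- (2 * t))).
    set (p := Re (phi (S (S n)) (RtoC (- t)))) in *.
    set (q := Re (phi (S (S n)) (RtoC (- (2 * t))))) in *.
    set (u := Re (phi (S n) (RtoC (- t)))) in *.
    set (v := Re (phi (S n) (RtoC (- (2 * t))))) in *.
    set (w := / INR (fact (S n))) in *.
    rewrite <- RtoC_mult, <- RtoC_minus in H1, H2.
    apply RtoC_inj in H1. apply RtoC_inj in H2.
    rewrite <- RtoC_minus, Cmod_div by (intros E; apply RtoC_inj in E; lra).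
    rewrite !Cmod_R, !Rabs_pos_eq by lra.
    apply Rmult_lt_reg_r with p; [ lra | ].
    replace ((p - q) / p * p) with (p - q) by (field; lra).
    nra.
  - rewrite Ropp_0, CC_quotient by (apply phi_neq_0; simpl; lra).
    rewrite Cmult_0_r. unfold Cdiv, Cminus. rewrite Cplus_opp_r, Cmult_0_l, Cmod_0.
    lra.
Qed.

Lemma CC_norm_conj (n : nat) (z : C) :
  Re z <= 0 -> Cmod (CC (S (S n)) (Cconj z)) = Cmod (CC (S (S n)) z).
Proof.
  intros Hz. rewrite <- (Cmod_conj (CC (S (S n)) z)). f_equal.
  unfold CC.
  replace (2 * Cconj z)%C with (Cconj (2 * z))
    by (apply injective_projections; simpl; ring).
  rewrite !phi_conj, Cminus_conj, Cdiv_conj by now apply phi_neq_0.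
  f_equal. apply injective_projections; simpl; ring.
Qed.

Theorem theorem3p4 :
  forall l : nat, (2 <= l)%nat ->
  (forall t : R, 0 <= t ->
     Cmod (CC l (Ci * RtoC t)%C) - 2 * Cmod (CC l (RtoC (- t))) <= 0) ->
  forall x y : R, x < 0 ->
  Cmod (CC l (RtoC x + Ci * RtoC y)%C) < 1.
Proof.
  intros l Hl Hyp x y Hx.
  destruct l as [ | [ | n ] ]; [ lia | lia | ].
  replace (RtoC x + Ci * RtoC y)%C with ((x, y) : C)
    by (apply injective_projections; simpl; ring).
  assert (Haxis : forall t, Cmod (CC (S (S n)) (0, t)) < 1).
  { assert (Hpos : forall t, 0 <= t -> Cmod (CC (S (S n)) (0, t)) < 1).
    { intros t Ht.
      replace ((0, t) : C) with (Ci * RtoC t)%C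
        by (apply injective_projections; simpl; ring).
      generalize (Hyp t Ht) (CC_negative_real_lt n t Ht). lra. }
    intros t. destruct (Rle_dec 0 t) as [Ht | Ht]; [ now apply Hpos | ].
    rewrite <- CC_norm_conj by (simpl; lra).
    apply (Hpos (- t)). lra. }
  set (R0 := 24 * INR (S n) + Rabs x + Rabs y).
  assert (Hn := pos_INR (S n)).
  assert (HR0 : 24 * INR (S n) <= R0 /\ Rabs x <= R0 /\ Rabs y <= R0 /\ 0 <= R0).
  { unfold R0. generalize (Rabs_pos x) (Rabs_pos y). lra. }
  assert (Hexp : forall s t, - R0 <= s <= 0 -> - R0 <= t <= R0 ->
            expands2 (CC (S (S n))) (s, t)).
  { intros s t Hs _. apply CC_expands2. simpl. lra. }
  (* the values on the axis stay away from 1 by compactness of the segment *)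
  destruct (max_attained_rectangle (fun s t => Cmod (CC (S (S n)) (s, t)) ^ 2)
    0 0 (- R0) R0) as (p & q & Hp & Hq & Hmax); [ lra | lra | | ].
  { intros s t Hs Ht. apply expands2_continuous, Hexp; lra. }
  assert (p = 0) by lra. subst p.
  set (M := Rmax (3 / 4) (Cmod (CC (S (S n)) (0, q)))).
  apply Rle_lt_trans with M.
  - apply (maximum_principle_rectangle (CC (S (S n))) (- R0) 0 (- R0) R0);
      [ lra | lra | | exact Hexp | | | ].
    + apply Rle_trans with (3 / 4); [ lra | apply Rmax_l ].
    + intros s t Hs Ht Hside.
      destruct (Req_dec s 0) as [-> | Hs0].
      * eapply Rle_trans; [ | apply Rmax_r ].
        generalize (Hmax 0 t ltac:(lra) Ht) (Cmod_ge_0 (CC (S (S n)) (0, q)))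
          (Cmod_ge_0 (CC (S (S n)) (0, t))). cbv beta. nra.
      * eapply Rle_trans; [ | apply Rmax_l ].
        apply CC_norm_le_far; [ simpl; lra | ].
        apply Rle_trans with R0; [ lra | ].
        eapply Rle_trans; [ | apply Rmax_Cmod ]. simpl.
        assert (Hc : Rabs s = R0 \/ Rabs t = R0).
        { destruct Hside as [-> | [-> | [-> | ->]]];
            [ left | lra | right | right ];
            rewrite ?Rabs_Ropp; apply Rabs_pos_eq; lra. }
        destruct Hc as [<- | <-]; [ apply Rmax_l | apply Rmax_r ].
    + generalize (Rle_abs (- x)). rewrite Rabs_Ropp. lra.
    + generalize (Rle_abs (- y)) (Rle_abs y). rewrite Rabs_Ropp. lra.
  - apply Rmax_lub_lt; [ lra | apply Haxis ].
Qed.
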